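(* Let $d\ge 1$, and let $u_1,\dots,u_k$ and $v_1,\dots,v_m$ be linear forms on $\mathbb{R}^d$ with coefficients in $\mathbb{N}=\{1,2,3,\dots\}$, such that $\sum_{i=1}^{k}u_i(X)=\sum_{i=1}^{m}v_i(X)$ for all $X\in\mathbb{R}^d$. Then the following two statements are equivalent. (1) For every $X=(x_1,\dots,x_d)\in\mathbb{N}^d$, $$\frac{\prod_{i=1}^{k}u_i(X)!}{\prod_{i=1}^{m}v_i(X)!}\in\mathbb{N}.$$ (2) For every $l\in\mathbb{N}$ and every $X\in\mathbb{Z}^d$ such that all the numbers $\{u_i(X)/l\}$ ($1\le i\le k$) and $\{v_j(X)/l\}$ ($1\le j\le m$) are non-zero, the point $$P=\Big(\{\tfrac{-u_1(X)}{l}\},\dots,\{\tfrac{-u_k(X)}{l}\},\{\tfrac{v_1(X)}{l}\},\dots,\{\tfrac{v_m(X)}{l}\}\Big)\in T^{k+m}$$ defines a Gorenstein cyclic quotient singularity whose Shokurov minimal log-discrepancy is at least $k$; that is, for every integer $t$ with $1\le t\le l-1$ such that all coordinates of the multiple $\big(\{t P_1\},\dots,\{t P_{k+m}\}\big)$ are non-zero, one has $\sum_{j=1}^{k+m}\{tP_j\}\ge k$.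
   Context: $\{x\}=x-[x]$ denotes the fractional part and $[x]$ the integer part (floor) of a real number $x$. $T^N=\{(w_1,\dots,w_N)\in\mathbb{R}^N: 0\le w_i<1\}$ is the standard torus. A point $w=(w_1,\dots,w_N)\in T^N$ with rational coordinates, all of denominator dividing $l$, defines the cyclic quotient singularity $\mathbb{C}^N/\mu_l$ where $\mu\in\mu_l$ acts by multiplying the $i$-th coordinate by $\mu^{l w_i}$. Its multiples are the points $(\{t w_1\},\dots,\{t w_N\})$ for $t=1,\dots,l-1$. The Shokurov minimal log-discrepancy of the singularity is the minimum of $\sum_i \{t w_i\}$ over those multiples all of whose coordinates are non-zero (i.e. lying strictly inside $T^N$). The singularity is Gorenstein if $\sum_i w_i$ is an integer (for $P$ above this holds automatically since $\sum u_i=\sum v_i$). *)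

(* Defs.v *)
From HB Require Import structures.
From mathcomp Require Import all_boot all_order all_algebra.
From mathcomp Require Import reals constructive_ereal.

Set Implicit Arguments.
Unset Strict Implicit.
Unset Printing Implicit Defensive.

Import Order.TTheory GRing.Theory Num.Theory.
Local Open Scope ring_scope.

(* The linear form x |-> a_1 x_1 + ... + a_d x_d, where a is the vector of its
   natural coefficients; V is instantiated with nat, int or the real numbers. *)
Definition linform (d : nat) (a : 'rV[nat]_d) (V : nmodType) (x : 'rV[V]_d) : V :=
  \sum_(j < d) x 0 j *+ a 0 j.
Arguments linform {d} a {V} x.

Definition fpart (R : realType) (x : R) : R := x - (Num.floor x)%:~R.

Definition in_torus (R : realType) (N : nat) (w : 'rV[R]_N) : Prop :=
  forall i, 0 <= w 0 i < 1.

(* The condition under which w defines the cyclic quotient singularity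
   C^N / mu_l, where z in mu_l multiplies the i-th coordinate by
   z ^ (l * w_i): the exponents l * w_i have to be integers. *)
Definition cyclic_quotient (R : realType) (l N : nat) (w : 'rV[R]_N) : Prop :=
  in_torus w /\ forall i, w 0 i *+ l \is a Num.int.

Definition gorenstein (R : realType) (N : nat) (w : 'rV[R]_N) : Prop :=
  \sum_(i < N) w 0 i \is a Num.int.

Definition multiple (R : realType) (N : nat) (t : nat) (w : 'rV[R]_N) : 'rV[R]_N :=
  \row_i fpart (w 0 i *+ t).

Definition interior_point (R : realType) (N : nat) (w : 'rV[R]_N) : bool :=
  [forall i, w 0 i != 0].

(* Shokurov minimal log-discrepancy of C^N / mu_l. The minimum is taken in the
   extended reals; it is +oo when no multiple t * w with 1 <= t <= l - 1 has
   all its coordinates non-zero. *)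
Definition mld (R : realType) (l N : nat) (w : 'rV[R]_N) : \bar R :=
  \big[Order.min/+oo%E]_(1 <= t < l | interior_point (multiple t w))
    (\sum_(i < N) multiple t w 0 i)%:E.

Lemma le_mldP (R : realType) (l N : nat) (w : 'rV[R]_N) (x : R) :
  (x%:E <= mld l w)%E <->
  (forall t : nat, (1 <= t <= l.-1)%N ->
     (forall i, fpart (w 0 i *+ t) != 0) -> x <= \sum_(i < N) fpart (w 0 i *+ t)).
Proof.
have sumE t : \sum_(i < N) multiple t w 0 i = \sum_(i < N) fpart (w 0 i *+ t).
  by apply: eq_bigr => i _; rewrite mxE.
have intE t : interior_point (multiple t w) <->
    (forall i, fpart (w 0 i *+ t) != 0).
  split=> [/forallP h i|h]; first by have := h i; rewrite mxE.
  by apply/forallP => i; rewrite mxE.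
have rngE t : (t \in index_iota 1 l) = (1 <= t <= l.-1)%N.
  by rewrite mem_index_iota; case: l => [|l] //=; rewrite ltn0 andbF; case: t.
rewrite /mld; split=> [h t tl nz|h].
  move: tl h; rewrite -rngE; elim: (index_iota 1 l) => //= s r IH.
  rewrite inE big_cons => /predU1P[<-|tr].
    by rewrite (introT idP ((intE t).2 nz)) le_min sumE lee_fin => /andP[].
  by case: ifP => _; [rewrite le_min => /andP[_ /(IH tr)] | move/(IH tr)].
rewrite big_seq_cond.
apply: (big_ind (fun y => x%:E <= y)%E) => [|a b ha hb|t /andP[tl nz]].
- by rewrite leey.
- by rewrite le_min ha.
- by rewrite lee_fin sumE h -?rngE //; apply/intE.
Qed.

Definition pointP (R : realType) (d k m : nat)
    (u : 'I_k -> 'rV[nat]_d) (v : 'I_m -> 'rV[nat]_d)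
    (l : nat) (X : 'rV[int]_d) : 'rV[R]_(k + m) :=
  row_mx (\row_i fpart (- (linform (u i) X)%:~R / l%:R))
         (\row_j fpart ((linform (v j) X)%:~R / l%:R)).
Arguments pointP R {d k m} u v l X.

(* Main.v *)
(* Landau's criterion links both conditions: the quotients of factorials are
   integers iff D(a, l) = sum_i [u_i(a) / l] - sum_j [v_j(a) / l] is nonnegative
   for all vectors a of natural numbers and all l > 0. The p-adic valuation of
   the quotient at x is the sum of the D(x, p ^ e); conversely, for a large
   prime p and y just above p a / l, only e = 1 contributes and
   D(y, p) = D(a, l). On the other hand, since {-z} = 1 - {z} for z not an
   integer, the coordinates of t P have sum k + D(t X, l). *)
Require Import Defs.
From HB Require Import structures.
From mathcomp Require Import all_boot all_order all_algebra.
From mathcomp Require Import reals constructive_ereal.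

Set Implicit Arguments.
Unset Strict Implicit.
Unset Printing Implicit Defensive.

Import Order.TTheory GRing.Theory Num.Theory.
Local Open Scope ring_scope.

(** * Linear forms with natural coefficients, over any commutative monoid *)

Lemma linform_raddf (d : nat) (c : 'rV[nat]_d) (V W : nmodType)
    (f : {additive V -> W}) (x : 'rV[V]_d) :
  linform c (map_mx f x) = f (linform c x).
Proof.
by rewrite /linform raddf_sum; apply: eq_bigr => j _; rewrite mxE raddfMn.
Qed.

Lemma linformD (d : nat) (c : 'rV[nat]_d) (V : nmodType) (x y : 'rV[V]_d) :
  linform c (x + y) = linform c x + linform c y.
Proof.
by rewrite /linform -big_split; apply: eq_bigr => j _; rewrite mxE mulrnDl.
Qed.

Lemma linformMn (d : nat) (c : 'rV[nat]_d) (V : nmodType) (x : 'rV[V]_d) n :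
  linform c (x *+ n) = linform c x *+ n.
Proof.
by rewrite /linform -sumrMnl; apply: eq_bigr => j _; rewrite mulmxnE mulrnAC.
Qed.

Lemma mulrn_nat (a n : nat) : a *+ n = (a * n)%N.
Proof. by elim: n => [|n IH]; rewrite ?muln0 // mulrS mulnS IH. Qed.

Lemma linformM_nat (d : nat) (c : 'rV[nat]_d) (x : 'rV[nat]_d) n :
  linform c (x *+ n) = (n * linform c x)%N.
Proof. by rewrite linformMn mulrn_nat mulnC. Qed.

Lemma leq_linform (d : nat) (c x y : 'rV[nat]_d) :
  (forall j, x 0%R j <= y 0%R j)%N -> (linform c x <= linform c y)%N.
Proof. by move=> h; apply: leq_sum => j _; rewrite !mulrn_nat leq_mul. Qed.

Lemma linform_ones_gt0 (d : nat) (c : 'rV[nat]_d) :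
  (0 < d)%N -> (forall j, 0 < c 0%R j)%N -> (0 < linform c (const_mx 1%N))%N.
Proof.
case: d c => // d c _ h; rewrite /linform big_ord_recl mxE mulrn_nat mul1n.
by rewrite ltn_addr.
Qed.

Lemma sum_linform_coef (d k : nat) (u : 'I_k -> 'rV[nat]_d) (V : nmodType)
    (x : 'rV[V]_d) :
  \sum_i linform (u i) x = \sum_j x 0 j *+ (\sum_i u i 0%R j)%N.
Proof.
by rewrite /linform exchange_big; apply: eq_bigr => j _; rewrite sumrMnr.
Qed.

(** Evaluating at the basis vectors compares the sums of coefficients, which are equal in [nat] by
    characteristic zero; so the identity passes from [R] to [nat] and [int]. *)
Lemma linform_sum_eq_coef (R : numDomainType) (d k m : nat)
    (u : 'I_k -> 'rV[nat]_d) (v : 'I_m -> 'rV[nat]_d) :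
  (forall x : 'rV[R]_d, \sum_i linform (u i) x = \sum_i linform (v i) x) ->
  forall (V : nmodType) (x : 'rV[V]_d),
    \sum_i linform (u i) x = \sum_i linform (v i) x.
Proof.
move=> uv V x; rewrite !sum_linform_coef; apply: eq_bigr => j _.
have coefE (c : 'I_d -> nat) :
    \sum_j' (delta_mx 0 j : 'rV[R]_d) 0 j' *+ c j' = (c j)%:R.
  rewrite (bigD1 j) //= big1 ?addr0 => [|i /negPf ij]; rewrite !mxE !eqxx ?ij //.
  by rewrite mul0rn.
have := uv (delta_mx 0 j); rewrite !sum_linform_coef !coefE => /eqP.
by rewrite eqr_nat => /eqP ->.
Qed.

(** * Landau's criterion for quotients of factorials *)

Definition landau (d k m : nat) (u : 'I_k -> 'rV[nat]_d) (v : 'I_m -> 'rV[nat]_d) :=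
  forall (l : nat) (a : 'rV[nat]_d), (0 < l)%N ->
    (\sum_j linform (v j) a %/ l <= \sum_i linform (u i) a %/ l)%N.

(** In Legendre's formula the terms with [e > n] vanish because [n < p ^ e]. A range common to
    several factorials allows the sums over [e] to be exchanged. *)
Lemma logn_fact_widen (p n N : nat) :
  prime p -> (n <= N)%N -> logn p n`! = (\sum_(1 <= e < N.+1) n %/ p ^ e)%N.
Proof.
move=> pp nN; rewrite logn_fact // (@big_cat_nat _ _ _ n.+1 1 N.+1) //=.
rewrite [X in (_ + X)%N]big_nat_cond [X in (_ + X)%N]big1 ?addn0 //.
move=> e; rewrite andbT => /andP[ne _]; apply: divn_small.
by apply: leq_trans ne _; rewrite ltnW // ltn_expl // prime_gt1.
Qed.

Lemma logn_prod_fact (p k : nat) (n : 'I_k -> nat) :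
  logn p (\prod_i (n i)`!)%N = (\sum_i logn p (n i)`!)%N.
Proof.
have [] // : logn p (\prod_i (n i)`!)%N = (\sum_i logn p (n i)`!)%N /\
  (0 < \prod_i (n i)`!)%N.
elim/big_rec2: _ => [|i y x _ [<- x0]]; first by rewrite logn1.
by rewrite lognM ?muln_gt0 ?fact_gt0 //.
Qed.

(** Here [y / p] exceeds [x / l] by at most [S / p < 1 / l], while the next integer above [x / l] is
    at distance at least [1 / l]. *)
Lemma divn_perturb (p l S x y : nat) : (0 < l)%N -> (l * S < p)%N ->
  (p * x < l * y)%N -> (l * y <= p * x + l * S)%N -> (y %/ p = x %/ l)%N.
Proof.
move=> l0 Sp xy yx.
have p0 : (0 < p)%N by apply: leq_ltn_trans Sp.
apply/eqP; rewrite eqn_leq -ltnS ltn_divLR // leq_divRL //.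
apply/andP; split; [rewrite -(ltn_pmul2l l0) | rewrite -(leq_pmul2l l0)].
  apply: leq_ltn_trans yx _.
  have := ltn_ceil x l0; rewrite -(leq_pmul2l p0) mulnS addnC => h.
  rewrite [ltnRHS](_ : _ = (p * ((x %/ l).+1 * l))%N); last first.
    by rewrite [RHS]mulnC -mulnA [LHS]mulnCA mulnA.
  by apply: leq_trans h; rewrite ltn_add2l.
apply: leq_trans (ltnW xy); rewrite mulnCA mulnA [leqLHS]mulnC leq_mul2l.
by rewrite leq_trunc_div orbT.
Qed.

(** The [p]-adic valuations are compared term by term: exponent [e] of Legendre's formula is the
    hypothesis at [q = p ^ e]. *)
Lemma dvdn_prod_fact_of_divn_le (k m : nat) (a : 'I_k -> nat) (b : 'I_m -> nat) :
  (forall q, 0 < q -> \sum_j b j %/ q <= \sum_i a i %/ q)%N ->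
  (\prod_j (b j)`! %| \prod_i (a i)`!)%N.
Proof.
move=> ba; have pos n (c : 'I_n -> nat) : (0 < \prod_i (c i)`!)%N.
  by apply: prodn_gt0 => i; exact: fact_gt0.
apply/dvdn_partP => // p; rewrite mem_primes => /and3P[pp _ _].
rewrite p_part pfactor_dvdn // !logn_prod_fact.
pose N := (\sum_i a i + \sum_j b j)%N.
under eq_bigr => j _.
  rewrite (@logn_fact_widen p (b j) N) //; last first.
    by rewrite (leq_trans _ (leq_addl _ _)) // (bigD1 j) //= leq_addr.
  over.
under [leqRHS]eq_bigr => i _.
  rewrite (@logn_fact_widen p (a i) N) //; last first.
    by rewrite (leq_trans _ (leq_addr _ _)) // (bigD1 i) //= leq_addr.
  over.
rewrite exchange_big [leqRHS]exchange_big /=; apply: leq_sum => e _.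
by apply: ba; rewrite expn_gt0 prime_gt0.
Qed.

Lemma logn_fact_lt_sqr (p n : nat) :
  prime p -> (n < p ^ 2)%N -> logn p n`! = (n %/ p)%N.
Proof.
move=> pp np; rewrite (@logn_fact_widen p n n.+1) // big_ltn // expn1.
rewrite big_nat_cond big1 ?addn0 // => e; rewrite andbT => /andP[e2 _].
by apply: divn_small; apply: leq_trans np _; rewrite leq_pexp2l ?prime_gt0.
Qed.

Lemma landau_of_dvdn (d k m : nat)
    (u : 'I_k -> 'rV[nat]_d) (v : 'I_m -> 'rV[nat]_d) :
  (0 < d)%N ->
  (forall i j, 0 < u i 0%R j)%N -> (forall i j, 0 < v i 0%R j)%N ->
  (forall x : 'rV[nat]_d, \sum_i linform (u i) x = \sum_j linform (v j) x) ->
  (forall x : 'rV[nat]_d, (forall j, 0 < x 0%R j)%N ->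
     (\prod_j (linform (v j) x)`! %| \prod_i (linform (u i) x)`!)%N) ->
  landau u v.
Proof.
move=> d0 u0 v0 uv dv l a l0.
pose one : 'rV[nat]_d := const_mx 1%N.
pose S := (\sum_i linform (u i) one)%N; pose A := (\sum_i linform (u i) a)%N.
(* [p > l * S] is what [divn_perturb] asks for; [p > A] keeps all values of the forms at [y] below
   [p ^ 2]. *)
have [p pb pp] := prime_above (l * S + A)%N.
have pS : (l * S < p)%N by apply: leq_ltn_trans pb; exact: leq_addr.
have pA : (A < p)%N by apply: leq_ltn_trans pb; exact: leq_addl.
have p0 := prime_gt0 pp.
(* The least integer vector strictly above [p a / l] in each coordinate; it is positive even where
   [a] vanishes. *)
pose y : 'rV[nat]_d := \row_j (p * a 0 j %/ l).+1.
have divE (c : 'rV[nat]_d) :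
    (0 < linform c one)%N -> (linform c one <= S)%N -> (linform c a <= A)%N ->
    logn p (linform c y)`! = (linform c a %/ l)%N.
  move=> c0 cS cA.
  have yE : (linform c y %/ p)%N = (linform c a %/ l)%N.
    apply: (divn_perturb l0 pS); rewrite -!linformM_nat.
      (* Each [l * y_j] is at least [p * a_j + 1]; the inequality for the form is strict since
         [linform c one > 0]. *)
      apply: (@leq_trans (linform c (a *+ p + one))).
        by rewrite linformD -addn1 leq_add2l.
      apply: leq_linform => j; rewrite !(mxE, mulmxnE) !mulrn_nat.
      by rewrite [(a 0%R j * p)%N]mulnC -[(_ + _)%R]/(_ + _)%N addn1 ltn_ceil.
    apply: (@leq_trans (linform c (a *+ p + one *+ l))).
      apply: leq_linform => j; rewrite !(mxE, mulmxnE) !mulrn_nat.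
      rewrite -[(_ + _)%R]/(_ + _)%N.
      by rewrite mulSn mul1n addnC [(a 0%R j * p)%N]mulnC leq_add2r leq_trunc_div.
    by rewrite linformD (linformM_nat c one) leq_add2l leq_mul2l cS orbT.
  rewrite logn_fact_lt_sqr //.
  rewrite expnS expn1 -ltn_divLR // yE (leq_ltn_trans _ pA) //.
  exact: leq_trans (leq_div _ _) cA.
have leS n (w : 'I_n -> 'rV[nat]_d) i x :
    (linform (w i) x <= \sum_i linform (w i) x)%N.
  by rewrite (bigD1 i) //= leq_addr.
have y0 j : (0 < y 0%R j)%N by rewrite mxE.
have := dvdn_leq_log p _ (dv y y0).
rewrite !logn_prod_fact prodn_gt0 => [/(_ isT)|i]; last exact: fact_gt0.
congr (_ <= _)%N; apply: eq_bigr => i _; apply: divE.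
- exact: linform_ones_gt0.
- by rewrite [S]uv leS.
- by rewrite [A]uv leS.
- exact: linform_ones_gt0.
- exact: leS.
- exact: leS.
Qed.

(** * Fractional parts and floors *)

Lemma fpart_int (R : realType) (x : R) : (fpart x == 0) = (x \is a Num.int).
Proof. by rewrite intrEfloor subr_eq0 eq_sym. Qed.

Lemma fpartDz (R : realType) (x y : R) :
  y \is a Num.int -> fpart (x + y) = fpart x.
Proof.
move=> yz; rewrite /fpart floorDrz // intrD (floorK yz) opprD addrACA.
by rewrite subrr addr0.
Qed.

Lemma fpart_subz (R : realType) (x : R) : exists z : int, fpart x = x + z%:~R.
Proof. by exists (- Num.floor x); rewrite mulrNz. Qed.

Lemma fpartMn (R : realType) (x : R) t : fpart (fpart x *+ t) = fpart (x *+ t).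
Proof.
have [z ->] := fpart_subz x; rewrite mulrnDl fpartDz //.
by rewrite rpredMn // intr_int.
Qed.

Lemma fpart_ge0_lt1 (R : realType) (x : R) : 0 <= fpart x < 1.
Proof.
have /andP[x0 x1] := floor_itv x.
by rewrite /fpart subr_ge0 x0 ltrBlDl -[1]/(1%:~R) -intrD.
Qed.

Lemma fpartN (R : realType) (x : R) :
  x \isn't a Num.int -> fpart (- x) = 1 - fpart x.
Proof.
(* The ceiling is the floor plus the boolean [x \isn't a Num.int], here [true]; this is the 1 of the
   formula. *)
move=> xz; have := ceil_floor x; rewrite xz => /eqP.
rewrite /fpart ceilNfloor eqr_oppLR => /eqP ->.
by rewrite mulrNz opprK intrD opprB addrC [_ + true%:~R]addrC addrA.
Qed.

Lemma floor_divn (R : realType) (n l : nat) :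
  (0 < l)%N -> Num.floor (n%:R / l%:R : R) = (n %/ l)%N.
Proof.
move=> l0; apply: floor_def; have l0' : (0 : R) < l%:R by rewrite ltr0n.
rewrite ler_pdivlMr // ltr_pdivrMr // -PoszD addn1 -!pmulrn -!natrM ler_nat ltr_nat.
by rewrite leq_trunc_div ltn_ceil.
Qed.

Lemma int_divn (R : realType) (n l : nat) :
  (0 < l)%N -> (n%:R / l%:R : R) \is a Num.int -> (l %| n)%N.
Proof.
move=> l0 /floorK; rewrite floor_divn // -pmulrn => e.
have l0' : (l%:R : R) != 0 by rewrite pnatr_eq0 -lt0n.
move/(canLR (divfK l0'))/eqP: e.
by rewrite -natrM eqr_nat => /eqP <-; rewrite dvdn_mull.
Qed.

(** With [{-z} = 1 - {z}] the left-hand sum is [k] plus the difference of the two sums of floors, as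
    the sums of [x] and [y] cancel. *)
Lemma le_sum_fpart (R : realType) (k m : nat) (x : 'I_k -> R) (y : 'I_m -> R) :
  \sum_i x i = \sum_j y j -> (forall i, x i \isn't a Num.int) ->
  (k%:R <= \sum_i fpart (- x i) + \sum_j fpart (y j)) =
  (\sum_j Num.floor (y j) <= \sum_i Num.floor (x i)).
Proof.
move=> xy xz; under eq_bigr => i _ do rewrite fpartN //.
rewrite !sumrB sumr_const card_ord -addrA lerDl xy.
by rewrite opprB addrA subrK -!rmorph_sum subr_ge0 ler_int.
Qed.

(** Write [x = a + l b] with [a] the residues modulo [l]. Each floor is its value at [a] plus the
    form at [b], and the latter have equal sums on both sides. *)
Lemma landau_int (R : realType) (d k m : nat)
    (u : 'I_k -> 'rV[nat]_d) (v : 'I_m -> 'rV[nat]_d) (l : nat) (x : 'rV[int]_d) :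
  (forall x : 'rV[int]_d, \sum_i linform (u i) x = \sum_j linform (v j) x) ->
  landau u v -> (0 < l)%N ->
  \sum_j Num.floor ((linform (v j) x)%:~R / l%:R : R) <=
  \sum_i Num.floor ((linform (u i) x)%:~R / l%:R : R).
Proof.
move=> uv uvl l0.
pose a : 'rV[nat]_d := \row_j `|(x 0%R j %% l)%Z|%N.
pose b : 'rV[int]_d := \row_j (x 0%R j %/ l)%Z.
have xE : x = map_mx Posz a + b *+ l.
  apply/rowP => j; rewrite !(mxE, mulmxnE) gez0_abs ?modz_ge0 -?lt0n //.
  by rewrite addrC -mulr_natr natz -divz_eq.
have floorE (c : 'rV[nat]_d) :
    Num.floor ((linform c x)%:~R / l%:R : R) = (linform c a %/ l)%N%:Z + linform c b.
  rewrite {1}xE linformD linformMn linform_raddf intrD mulrDl.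
  have -> : (linform c b *+ l)%:~R / l%:R = (linform c b)%:~R :> R.
    by rewrite rmorphMn /= -mulr_natr mulfK // pnatr_eq0 -lt0n.
  by rewrite floorDrz ?intr_int // intrKfloor -pmulrn floor_divn.
under eq_bigr => j _ do rewrite floorE.
under [leRHS]eq_bigr => i _ do rewrite floorE.
rewrite !big_split /= uv lerD2r.
by have := uvl l a l0; rewrite -lez_nat !raddf_sum.
Qed.

(** * The singularity attached to an integer vector and its log-discrepancy *)

Lemma sum_pointP_multiple (R : realType) (d k m : nat)
    (u : 'I_k -> 'rV[nat]_d) (v : 'I_m -> 'rV[nat]_d) (l t : nat) (x : 'rV[int]_d) :
  \sum_i fpart (pointP R u v l x 0 i *+ t) =
  \sum_i fpart (- ((linform (u i) (x *+ t))%:~R / l%:R : R)) +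
  \sum_j fpart ((linform (v j) (x *+ t))%:~R / l%:R : R).
Proof.
rewrite big_split_ord /=; congr (_ + _); apply: eq_bigr => i _.
  by rewrite row_mxEl mxE fpartMn linformMn rmorphMn /= mulNr mulNrn mulrnAl.
by rewrite row_mxEr mxE fpartMn linformMn rmorphMn /= mulrnAl.
Qed.

Lemma sum_linform_div (R : realType) (d k m : nat)
    (u : 'I_k -> 'rV[nat]_d) (v : 'I_m -> 'rV[nat]_d) (l : nat) (x : 'rV[int]_d) :
  (forall x : 'rV[int]_d, \sum_i linform (u i) x = \sum_j linform (v j) x) ->
  \sum_i (linform (u i) x)%:~R / l%:R = \sum_j (linform (v j) x)%:~R / l%:R :> R.
Proof. by move=> uv; rewrite -!mulr_suml -!rmorph_sum uv. Qed.

Lemma mld_of_landau (R : realType) (d k m : nat)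
    (u : 'I_k -> 'rV[nat]_d) (v : 'I_m -> 'rV[nat]_d) (l : nat) (x : 'rV[int]_d) :
  (forall x : 'rV[int]_d, \sum_i linform (u i) x = \sum_j linform (v j) x) ->
  landau u v -> (0 < l)%N ->
  (k%:R%:E <= mld l (pointP R u v l x))%E.
Proof.
move=> uv uvl l0; apply/le_mldP => t _ nz.
rewrite sum_pointP_multiple le_sum_fpart ?landau_int ?(sum_linform_div _ _ _ uv) // => i.
(* A non-zero coordinate among the first [k] says that the [i]-th form at [x *+ t], divided by [l],
   is not an integer. *)
have := nz (lshift m i).
rewrite row_mxEl mxE fpartMn fpart_int mulNr mulNrn rpredN.
by rewrite linformMn rmorphMn /= mulrnAl.
Qed.

Lemma pointP_cyclic_quotient (R : realType) (d k m : nat)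
    (u : 'I_k -> 'rV[nat]_d) (v : 'I_m -> 'rV[nat]_d) (l : nat) (x : 'rV[int]_d) :
  (0 < l)%N -> cyclic_quotient l (pointP R u v l x).
Proof.
move=> l0; have l0' : (l%:R : R) != 0 by rewrite pnatr_eq0 -lt0n.
have zl (z : int) : fpart (z%:~R / l%:R : R) *+ l \is a Num.int.
  have [y ->] := fpart_subz (z%:~R / l%:R : R).
  by rewrite mulrnDl -[_ / _ *+ _]mulr_natr divfK // rpredD ?rpredMn ?intr_int.
split=> i; case: (split_ordP i) => j ->; rewrite ?row_mxEl ?row_mxEr mxE.
- exact: fpart_ge0_lt1.
- exact: fpart_ge0_lt1.
- by rewrite -rmorphN zl.
- exact: zl.
Qed.

(** Once the equal sums of the forms cancel, only integer parts remain. *)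
Lemma pointP_gorenstein (R : realType) (d k m : nat)
    (u : 'I_k -> 'rV[nat]_d) (v : 'I_m -> 'rV[nat]_d) (l : nat) (x : 'rV[int]_d) :
  (forall x : 'rV[int]_d, \sum_i linform (u i) x = \sum_j linform (v j) x) ->
  gorenstein (pointP R u v l x).
Proof.
move=> uv; rewrite /gorenstein big_split_ord /=.
under eq_bigr => i _ do rewrite row_mxEl mxE mulNr.
under [X in _ + X]eq_bigr => i _ do rewrite row_mxEr mxE.
rewrite !sumrB sumrN (sum_linform_div _ _ _ uv) addrACA addNr add0r.
by rewrite rpredD // rpredN rpred_sum // => i _; exact: intr_int.
Qed.

(* The floors of the forms at [a / q] are those at the nearby point
   [(M a + (1, ..., 1)) / (M q)], where no form is an integer if [M] is large. *)
Lemma landau_of_mld (R : realType) (d k m : nat)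
    (u : 'I_k -> 'rV[nat]_d) (v : 'I_m -> 'rV[nat]_d) :
  (0 < d)%N ->
  (forall i j, 0 < u i 0%R j)%N -> (forall i j, 0 < v i 0%R j)%N ->
  (forall (V : nmodType) (x : 'rV[V]_d),
     \sum_i linform (u i) x = \sum_j linform (v j) x) ->
  (forall (l : nat) (x : 'rV[int]_d), (0 < l)%N ->
     (forall i, fpart ((linform (u i) x)%:~R / l%:R : R) != 0) ->
     (forall j, fpart ((linform (v j) x)%:~R / l%:R : R) != 0) ->
     (k%:R%:E <= mld l (pointP R u v l x))%E) ->
  landau u v.
Proof.
move=> d0 u0 v0 uv mldP q a q0.
pose one : 'rV[nat]_d := const_mx 1%N.
(* [M] exceeds every form at [one], and [M >= 2] even if [S = 0], so that [t = 1] is at most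
   [l - 1]. *)
pose S := (\sum_i linform (u i) one)%N; pose M := S.+2.
have leS n (w : 'I_n -> 'rV[nat]_d) i :
    (linform (w i) one <= \sum_i linform (w i) one)%N.
  by rewrite (bigD1 i) //= leq_addr.
have uS i : (0 < linform (u i) one < M)%N.
  by rewrite linform_ones_gt0 //= ltnS ltnW // ltnS leS.
have vS j : (0 < linform (v j) one < M)%N.
  by rewrite linform_ones_gt0 //= ltnS ltnW // ltnS [S]uv leS.
pose x := map_mx Posz (a *+ M + one); pose l := (M * q)%N.
have l0 : (0 < l)%N by rewrite muln_gt0.
have xE (c : 'rV[nat]_d) :
    (linform c x)%:~R / l%:R = (M * linform c a + linform c one)%N%:R / l%:R :> R.
  by rewrite linform_raddf linformD linformM_nat -pmulrn.
have xint (c : 'rV[nat]_d) : (0 < linform c one < M)%N ->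
    ((linform c x)%:~R / l%:R : R) \isn't a Num.int.
  (* If [l] divided [M * linform c a + linform c one], then [M] would divide [linform c one], which
     lies strictly between 0 and [M]. *)
  move=> /andP[c0 cM]; rewrite xE; apply/negP => /(int_divn l0).
  move/(dvdn_trans (dvdn_mulr q (dvdnn M))); rewrite dvdn_addr ?dvdn_mulr //.
  by rewrite gtnNdvd.
have xfloor (c : 'rV[nat]_d) : (0 < linform c one < M)%N ->
    Num.floor ((linform c x)%:~R / l%:R : R) = (linform c a %/ q)%N.
  (* Dividing by [M] first removes [linform c one] and leaves [linform c a], to be divided by
     [q]. *)
  move=> /andP[_ cM]; rewrite xE floor_divn // divnMA mulnC divnMDl //.
  by rewrite (divn_small cM) addn0.
have xnz c (cM : (0 < linform c one < M)%N) :
    fpart ((linform c x)%:~R / l%:R : R) != 0.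
  by rewrite fpart_int xint.
have := mldP l x l0 (fun i => xnz _ (uS i)) (fun j => xnz _ (vS j)).
(* The multiple [t = 1], the point itself, already yields Landau's inequality at [a] and [q]. *)
move/le_mldP => /(_ 1%N); rewrite sum_pointP_multiple mulr1n.
rewrite (le_sum_fpart (sum_linform_div _ _ _ (uv int)) (fun i => xint _ (uS i))).
move=> kle; rewrite -lez_nat !raddf_sum /=.
under eq_bigr => j _ do rewrite -xfloor //.
under [leRHS]eq_bigr => i _ do rewrite -xfloor //.
apply: kle => [|i].
  by rewrite leqnn -ltnS (prednK l0) (leq_trans _ (leq_pmulr _ q0)).
rewrite mulr1n; case: (split_ordP i) => j ->.
  by rewrite row_mxEl mxE (fpartMn _ 1) mulNr fpart_int rpredN xint.
by rewrite row_mxEr mxE (fpartMn _ 1) xnz.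
Qed.

Theorem theorem11 (R : realType) (d k m : nat)
    (u : 'I_k -> 'rV[nat]_d) (v : 'I_m -> 'rV[nat]_d)
    (hd : (1 <= d)%N)
    (hu : forall i j, (0 < u i 0%R j)%N)
    (hv : forall i j, (0 < v i 0%R j)%N)
    (huv : forall X : 'rV[R]_d,
       \sum_(i < k) linform (u i) X = \sum_(i < m) linform (v i) X) :
  (forall X : 'rV[nat]_d, (forall j, (0 < X 0%R j)%N) ->
     exists2 n : nat, (0 < n)%N &
       (\prod_(i < k) (linform (u i) X)`!)%N%:R
         / (\prod_(i < m) (linform (v i) X)`!)%N%:R = n%:R :> rat)
  <->
  (forall (l : nat) (X : 'rV[int]_d), (0 < l)%N ->
     (forall i, fpart ((linform (u i) X)%:~R / l%:R : R) != 0) ->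
     (forall j, fpart ((linform (v j) X)%:~R / l%:R : R) != 0) ->
     [/\ cyclic_quotient l (pointP R u v l X),
         gorenstein (pointP R u v l X) &
         (k%:R%:E <= mld l (pointP R u v l X))%E]).
Proof.
have uv := linform_sum_eq_coef huv.
have pos n (w : 'I_n -> 'rV[nat]_d) X : (0 < \prod_i (linform (w i) X)`!)%N.
  by apply: prodn_gt0 => i; exact: fact_gt0.
have nz n (w : 'I_n -> 'rV[nat]_d) X :
    ((\prod_i (linform (w i) X)`!)%N%:R : rat) != 0.
  by rewrite pnatr_eq0 -lt0n.
split=> [h l X l0 _ _ | h X _].
  split; [exact: pointP_cyclic_quotient | exact: pointP_gorenstein |].
  apply: mld_of_landau => //; apply: landau_of_dvdn => // Y Y0.
  have [n _ /(canRL (divfK (nz _ v Y)))/eqP] := h Y Y0.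
  by rewrite -natrM eqr_nat => /eqP ->; rewrite dvdn_mull.
have uvl : landau u v by apply: landau_of_mld => // l X' l0 ? ?; case: (h l X').
have /dvdnP[n e] : (\prod_j (linform (v j) X)`! %| \prod_i (linform (u i) X)`!)%N.
  by apply: dvdn_prod_fact_of_divn_le => q q0; exact: uvl.
exists n; last by rewrite e natrM mulfK.
(* The numerator is positive and equals [n] times the denominator, hence [n > 0]. *)
by have := pos _ u X; rewrite e muln_gt0 => /andP[].
Qed.
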